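(* Let $m=2n+1$ samples $(x_i,t_i,F_i)$, $i=1,\dots,m$, be given, with center $x_k$ and center timestamp $t_k$, and suppose the observations come from a channel with affine drift $$F(x,t)=f(x)+\beta t+\varepsilon(x,t),$$ i.e. $F_i=f(x_i)+\beta t_i+\varepsilon(x_i,t_i)$, for some unknown drift rate $\beta\in\mathbb{R}$. Let $\mathbf t=(t_1,\dots,t_m)^\top$, $F=(F_1,\dots,F_m)^\top$, $F^{\mathrm{stat}}:=F-\beta\mathbf t\in\mathbb{R}^m$, and let $[c^{\mathrm{stat}},(g^{\mathrm{stat}})^\top,\gamma^{\mathrm{stat}}]^\top:=\Pi F^{\mathrm{stat}}$. If $\operatorname{rank}(X_{\mathrm{aug}})=n+2$, then the parameters $[c,g^\top,\gamma]^\top:=\Pi F$ recovered from the drifting data satisfy $$g=g^{\mathrm{stat}},\qquad \gamma=\gamma^{\mathrm{stat}}+\beta,\qquad c=c^{\mathrm{stat}}+\beta t_k.$$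
   Context: Here $f:\mathbb{R}^n\to\mathbb{R}$ is the latent objective and $\varepsilon(x,t)$ is observation noise. Put $d_i=x_i-x_k\in\mathbb{R}^n$, $\theta_i=t_i-t_k$, $\theta=(\theta_1,\dots,\theta_m)^\top$; $D\in\mathbb{R}^{m\times n}$ has rows $d_i^\top$; $\mathbf 1_m$ is the all-ones vector; $X_{\mathrm{aug}}=[\mathbf 1_m\;\;D\;\;\theta]\in\mathbb{R}^{m\times(n+2)}$. For a fixed $\rho>0$, $K=A+\tfrac1\rho I_m$ with $A_{ij}=\tfrac12(d_i^\top d_j)^2$ (a symmetric positive definite matrix), $S=X_{\mathrm{aug}}^\top K^{-1}X_{\mathrm{aug}}$ (invertible under the rank condition), and the recovery operator is $\Pi=S^{-1}X_{\mathrm{aug}}^\top K^{-1}\in\mathbb{R}^{(n+2)\times m}$. Vectors in $\mathbb{R}^{n+2}$ are split as $(c,g,\gamma)\in\mathbb{R}\times\mathbb{R}^n\times\mathbb{R}$. *)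

(* Defs.v *)
From mathcomp Require Import all_boot all_order all_algebra.
From mathcomp Require Import reals.
Set Implicit Arguments.
Unset Strict Implicit.
Unset Printing Implicit Defensive.
Import Order.TTheory GRing.Theory Num.Theory.
Local Open Scope ring_scope.

Section RecoveryOperator.
Variables (R : realType) (n m : nat).
Variables (x : 'I_m -> 'cV[R]_n) (t : 'I_m -> R) (xk : 'cV[R]_n) (tk rho : R).

Definition displ (i : 'I_m) : 'cV[R]_n := x i - xk.

Definition timevec : 'cV[R]_m := \col_i t i.

Definition theta : 'cV[R]_m := \col_i (t i - tk).

Definition Dmx : 'M[R]_(m, n) := \matrix_(i, j) displ i j 0.

Definition Xaug : 'M[R]_(m, 1 + (n + 1)) :=
  row_mx (const_mx 1) (row_mx Dmx theta).

Definition Amx : 'M[R]_m :=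
  \matrix_(i, j) (2^-1 * ((displ i)^T *m displ j) 0 0 ^+ 2).

Definition Kmx : 'M[R]_m := Amx + rho^-1 *: 1%:M.

Definition Smx : 'M[R]_(1 + (n + 1)) := Xaug^T *m invmx Kmx *m Xaug.

(* [invmx M] is [M] itself when [M] is singular; for [0 < rho] and [Xaug] of
   full column rank both inverses occurring here are genuine. *)
Definition recovery : 'M[R]_(1 + (n + 1), m) :=
  invmx Smx *m Xaug^T *m invmx Kmx.

End RecoveryOperator.

Section Components.
Variables (R : realType) (n : nat).
Implicit Type v : 'cV[R]_(1 + (n + 1)).

Definition c_part v : R := usubmx v 0 0.
Definition g_part v : 'cV[R]_n := usubmx (dsubmx v).
Definition gamma_part v : R := dsubmx (dsubmx v) 0 0.

End Components.

(* Main.v *)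
(** [S] is invertible because [A] is half the Gram matrix of the vectors
    [d_i (x) d_i], so that [K] is positive definite, and positive definiteness
    passes to [K^-1] and then to [X^T K^-1 X] for [X] of full column rank.
    Hence [Pi X = 1].  Since [t = X (t_k, 0, 1)^T], subtracting [beta t] from the
    data subtracts exactly [beta (t_k, 0, 1)^T] from the recovered parameters. *)
Require Import Defs.
From mathcomp Require Import all_boot all_order all_algebra.
From mathcomp Require Import reals.
Set Implicit Arguments.
Unset Strict Implicit.
Unset Printing Implicit Defensive.
Import Order.TTheory GRing.Theory Num.Theory.
Local Open Scope ring_scope.

(** Symmetry is not part of this notion; transposes are handled by [posdef_trmx]. *)
Definition posdef (R : realFieldType) m (M : 'M[R]_m) : Prop :=
  forall v : 'cV[R]_m, v != 0 -> 0 < (v^T *m M *m v) 0 0.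

Section PositiveDefinite.
Variable R : realFieldType.

Lemma dotmx_ge0 m (v : 'cV[R]_m) : 0 <= (v^T *m v) 0 0.
Proof. by rewrite mxE sumr_ge0 // => i _; rewrite mxE -expr2 sqr_ge0. Qed.

Lemma dotmx_gt0 m (v : 'cV[R]_m) : v != 0 -> 0 < (v^T *m v) 0 0.
Proof.
move=> v_neq0; rewrite lt_def dotmx_ge0 andbT; apply: contra_neq v_neq0 => v0.
apply/colP => i; rewrite [RHS]mxE; apply/eqP; rewrite -sqrf_eq0 expr2.
have /psumr_eq0P v0' : \sum_j v j 0 * v j 0 = 0.
  by rewrite -[RHS]v0 mxE; apply: eq_bigr => j _; rewrite mxE.
by apply/eqP/v0' => // j _; rewrite -expr2 sqr_ge0.
Qed.

(** A nonzero row [u] with [u *m M = 0] would make the quadratic form vanish at [u^T]. *)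
Lemma posdef_unitmx m (M : 'M[R]_m) : posdef M -> M \in unitmx.
Proof.
move=> M_pos; rewrite -row_free_unit -kermx_eq0; apply: contraT.
case/rowV0Pn => u /sub_kermxP uM u_neq0.
have := M_pos u^T; rewrite trmx_eq0 trmxK uM mul0mx mxE ltxx.
by move/(_ u_neq0).
Qed.

Lemma posdef_trmx m (M : 'M[R]_m) : posdef M -> posdef M^T.
Proof.
move=> M_pos v /M_pos; suff -> : v^T *m M^T *m v = (v^T *m M *m v)^T.
  by rewrite [X in _ -> 0 < X]mxE.
by rewrite !trmx_mul trmxK mulmxA.
Qed.

(** The form at [v] is that of [M] at [X *m v], which is nonzero because full column rank makes [X]
    injective. *)
Lemma posdef_congr m p (M : 'M[R]_m) (X : 'M[R]_(m, p)) :
  \rank X = p -> posdef M -> posdef (X^T *m M *m X).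
Proof.
move=> rkX M_pos v v_neq0.
have -> : v^T *m (X^T *m M *m X) *m v = (X *m v)^T *m M *m (X *m v).
  by rewrite trmx_mul !mulmxA.
apply: M_pos; rewrite -trmx_eq0 trmx_mul mulmx_free_eq0 ?trmx_eq0 //.
by rewrite /row_free mxrank_tr rkX.
Qed.

Lemma posdef_invmx m (M : 'M[R]_m) : posdef M -> posdef (invmx M).
Proof.
move=> M_pos; have M_unit := posdef_unitmx M_pos.
(* This exhibits the inverse as a congruence of [M^T] by an invertible matrix. *)
have -> : invmx M = (invmx M)^T^T *m M^T *m (invmx M)^T.
  by rewrite -mulmxA -trmx_mul mulVmx // trmx1 mulmx1 trmxK.
apply: posdef_congr (posdef_trmx M_pos).
by rewrite mxrank_tr mxrank_unit // unitmx_inv.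
Qed.

End PositiveDefinite.

Section Recovery.
Variables (R : realType) (n m : nat).
Variables (x : 'I_m -> 'cV[R]_n) (t : 'I_m -> R) (xk : 'cV[R]_n) (tk rho : R).

Definition tensor_mx : 'M[R]_(m, n * n) :=
  \matrix_(i < m) mxvec (displ x xk i *m (displ x xk i)^T).

(** The inner product of [d_i (x) d_i] and [d_j (x) d_j] is the square of that of [d_i] and
    [d_j]. *)
Lemma Amx_gram : Amx x xk = 2^-1 *: (tensor_mx *m tensor_mx^T).
Proof.
apply/matrixP => i j; rewrite !mxE; congr (_ * _).
set di := displ x xk i; set dj := displ x xk j.
transitivity ((mxvec (di *m di^T) *m (mxvec (dj *m dj^T))^T) 0 0); last first.
  by rewrite mxE; apply: eq_bigr => k _; rewrite !mxE.
(* The double transpose gives the shape [mxvec_dotmul] expects; the result [di^T dj dj^T di] is a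
   product of two scalars. *)
rewrite -[X in mxvec (X *m di^T)]trmxK mxvec_dotmul trmxK mulmxA -mulmxA [RHS]mxE big_ord1 expr2.
by congr (_ * _); rewrite [RHS]mxE; apply: eq_bigr => k _; rewrite !mxE // mulrC.
Qed.

(** With [T = tensor_mx], the form is half the squared norm of [T^T v] plus [rho^-1] times that of
    [v]; the second term is strictly positive. *)
Lemma Kmx_posdef : 0 < rho -> posdef (Kmx x xk rho).
Proof.
move=> rho_gt0 v v_neq0; rewrite /Kmx Amx_gram mulmxDr mulmxDl.
rewrite -!scalemxAr -!scalemxAl mulmx1.
have -> : v^T *m (tensor_mx *m tensor_mx^T) *m v =
          (tensor_mx^T *m v)^T *m (tensor_mx^T *m v).
  by rewrite trmx_mul trmxK !mulmxA.
rewrite mxE [X in X + _]mxE [X in _ + X]mxE.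
by rewrite ltr_wpDl ?mulr_ge0 ?invr_ge0 ?dotmx_ge0 // mulr_gt0 ?invr_gt0 ?dotmx_gt0.
Qed.

Lemma recovery_Xaug : 0 < rho -> \rank (Xaug x t xk tk) = (n + 2)%N ->
  recovery x t xk tk rho *m Xaug x t xk tk = 1%:M.
Proof.
move=> rho_gt0 rkX; rewrite /recovery -!mulmxA [X in _ *m X]mulmxA mulVmx //.
(* [addnCA] reconciles the rank [n + 2] with the block width [1 + (n + 1)]. *)
apply/posdef_unitmx/posdef_congr; first by rewrite rkX addnCA.
exact/posdef_invmx/Kmx_posdef.
Qed.

(** Row by row this is [t_i = t_k + (t_i - t_k)]: the drift direction lies in the column span of
    [Xaug]. *)
Lemma timevec_Xaug :
  timevec t = Xaug x t xk tk *m col_mx (const_mx tk) (col_mx 0 (const_mx 1)).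
Proof.
rewrite /Xaug !mul_row_col mulmx0 add0r; apply/colP => i.
by rewrite !mxE !big_ord1 !mxE mul1r mulr1 subrKC.
Qed.

End Recovery.

Theorem theorem3p5 (R : realType) (n : nat)
    (f : 'cV[R]_n -> R) (eps : 'cV[R]_n -> R -> R) (beta rho : R)
    (x : 'I_(2 * n + 1) -> 'cV[R]_n) (t : 'I_(2 * n + 1) -> R)
    (F : 'cV[R]_(2 * n + 1)) (xk : 'cV[R]_n) (tk : R)
    (rho_gt0 : 0 < rho)
    (F_channel : forall i, F i 0 = f (x i) + beta * t i + eps (x i) (t i))
    (rank_Xaug : \rank (Xaug x t xk tk) = (n + 2)%N) :
  let Fstat := F - beta *: timevec t in
  let Pi := recovery x t xk tk rho in
  [/\ g_part (Pi *m F) = g_part (Pi *m Fstat),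
      gamma_part (Pi *m F) = gamma_part (Pi *m Fstat) + beta
    & c_part (Pi *m F) = c_part (Pi *m Fstat) + beta * tk].
Proof.
move=> Fstat Pi.
have -> : Pi *m F = Pi *m Fstat +
    beta *: col_mx (const_mx tk) (col_mx 0 (const_mx 1)).
  rewrite -[F in LHS](subrK (beta *: timevec t)) mulmxDr -scalemxAr; congr (_ + _ *: _).
  by rewrite (timevec_Xaug x t xk tk) mulmxA recovery_Xaug ?mul1mx.
(* Taking blocks is linear, so each part shifts by [beta] times its block of the vector: [t_k], [0]
   or [1]. *)
rewrite /g_part /gamma_part /c_part !linearD !linearZ /= !(col_mxKu, col_mxKd).
by split; rewrite ?scaler0 ?addr0 // !mxE ?mulr1.
Qed.
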